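(* Let $n\ge 2$ and let $R$ and $S$ be elementarily equivalent (as rings) integral domains of characteristic zero. Then $$N_{2,n}(R,f^1,\ldots,f^n)\equiv N_{2,n}(S,g^1,\ldots,g^n)$$ (elementary equivalence of groups) for any symmetric 2-cocycles $f^i:R^+\times R^+\to\bigoplus_{1\le j<k\le n}R^+$ and $g^i:S^+\times S^+\to\bigoplus_{1\le j<k\le n}S^+$, $1\le i\le n$.
   Context: Two structures in the same language are elementarily equivalent ($\equiv$) if they satisfy the same first-order sentences. $R^+$ is the additive group of $R$. For abelian groups $A,B$, a 2-cocycle is a function $f:B\times B\to A$ with $f(0,x)=f(x,0)=0$ and $f(x+y,z)+f(x,y)=f(x,y+z)+f(y,z)$; it is symmetric if $f(x,y)=f(y,x)$ for all $x,y\in B$. For a ring $R$ with unit and symmetric 2-cocycles $f^1,\ldots,f^n:R^+\times R^+\to\bigoplus_{1\le j<k\le n}R^+$ with coordinates $f^i_{jk}$, $N_{2,n}(R,f^1,\ldots,f^n)$ is the set of all tuples $((\alpha_i)_{1\le i\le n},(\gamma_{ij})_{1\le i<j\le n})$ of elements of $R$ with the group multiplication $$((\alpha_i),(\gamma_{ij}))\odot((\beta_i),(\gamma'_{ij}))=\Big((\alpha_i+\beta_i),\big(\gamma_{ij}+\gamma'_{ij}+\alpha_i\beta_j+\sum_{k=1}^n f^k_{ij}(\alpha_k,\beta_k)\big)\Big).$$ *)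

(* Defs.v *)
From HB Require Import structures.
From mathcomp Require Import all_boot all_order all_algebra.
Set Implicit Arguments.
Unset Strict Implicit.
Unset Printing Implicit Defensive.
Import GRing.Theory.
Local Open Scope ring_scope.

(** * First-order logic with equality *)

Record language := Language {
  funsym : Type;
  fun_arity : funsym -> nat;
  relsym : Type;
  rel_arity : relsym -> nat
}.

Record structure (L : language) := Structure {
  carrier :> Type;
  fun_interp : forall s : funsym L, ('I_(fun_arity s) -> carrier) -> carrier;
  rel_interp : forall r : relsym L, ('I_(rel_arity r) -> carrier) -> Prop
}.
Arguments fun_interp {L} _ s _.
Arguments rel_interp {L} _ r _.

Inductive term (L : language) : Type :=
| Var of nat
| App (s : funsym L) of 'I_(fun_arity s) -> term L.
Arguments Var {L} _.
Arguments App {L} s _.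

(* The remaining connectives and the existential quantifier are definable from
   these, satisfaction being read in classical logic. *)
Inductive formula (L : language) : Type :=
| Bot
| Eq of term L & term L
| Rel (r : relsym L) of 'I_(rel_arity r) -> term L
| Imp of formula L & formula L
| All of nat & formula L.
Arguments Bot {L}.
Arguments Rel {L} r _.

Section Semantics.
Variable L : language.

Fixpoint term_free (x : nat) (t : term L) : Prop :=
  match t with
  | Var y => x = y
  | App s ts => exists i, term_free x (ts i)
  end.

Fixpoint free (x : nat) (phi : formula L) : Prop :=
  match phi with
  | Bot => False
  | Eq t u => term_free x t \/ term_free x u
  | Rel r ts => exists i, term_free x (ts i)
  | Imp p q => free x p \/ free x q
  | All y p => x <> y /\ free x p
  end.

Definition sentence (phi : formula L) : Prop := forall x, ~ free x phi.

Variable M : structure L.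

Definition update (v : nat -> M) (x : nat) (a : M) : nat -> M :=
  fun y => if y == x then a else v y.

Fixpoint eval (v : nat -> M) (t : term L) : M :=
  match t with
  | Var x => v x
  | App s ts => fun_interp M s (fun i => eval v (ts i))
  end.

Fixpoint sat (v : nat -> M) (phi : formula L) : Prop :=
  match phi with
  | Bot => False
  | Eq t u => eval v t = eval v u
  | Rel r ts => rel_interp M r (fun i => eval v (ts i))
  | Imp p q => sat v p -> sat v q
  | All x p => forall a : M, sat (update v x a) p
  end.

(* For a sentence the valuation is irrelevant: on a nonempty structure this
   is truth under any one valuation. *)
Definition models (phi : formula L) : Prop := forall v : nat -> M, sat v phi.

End Semantics.

Definition elem_equiv (L : language) (M N : structure L) : Prop :=
  forall phi : formula L, sentence phi -> (models M phi <-> models N phi).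

(** * Rings and groups as first-order structures *)

Variant ring_sym := RZero | ROne | ROpp | RAdd | RMul.

Definition ring_language : language :=
  @Language ring_sym
    (fun s => match s with RZero | ROne => 0 | ROpp => 1 | RAdd | RMul => 2 end)%N
    void (fun r => match r with end).

Definition ring_structure (R : pzRingType) : structure ring_language :=
  @Structure ring_language R
    (fun s : ring_sym =>
       match s return ('I_(@fun_arity ring_language s) -> R) -> R with
       | RZero => fun _ => 0
       | ROne => fun _ => 1
       | ROpp => fun a => - a ord0
       | RAdd => fun a => a ord0 + a ord_max
       | RMul => fun a => a ord0 * a ord_max
       end)
    (fun r : void => match r with end).

Variant group_sym := GOne | GInv | GMul.

Definition group_language : language :=
  @Language group_sym
    (fun s => match s with GOne => 0 | GInv => 1 | GMul => 2 end)%N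
    void (fun r => match r with end).

Definition group_structure (G : groupType) : structure group_language :=
  @Structure group_language G
    (fun s : group_sym =>
       match s return ('I_(@fun_arity group_language s) -> G) -> G with
       | GOne => fun _ => 1%g
       | GInv => fun a => (a ord0)^-1%g
       | GMul => fun a => (a ord0 * a ord_max)%g
       end)
    (fun r : void => match r with end).

(** * Symmetric 2-cocycles *)

Definition cocycle2 (B A : zmodType) (f : B -> B -> A) : Prop :=
  [/\ forall x, f 0 x = 0,
      forall x, f x 0 = 0
    & forall x y z, f (x + y) z + f x y = f x (y + z) + f y z].

Record sym_cocycle2 (B A : zmodType) := SymCocycle2 {
  cocycle_fun :> B -> B -> A;
  cocycle_funP : cocycle2 cocycle_fun;
  cocycle_symP : forall x y, cocycle_fun x y = cocycle_fun y x
}.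

(** * The groups N_{2,n}(R, f^1, ..., f^n) *)

(* The pairs of indices i < j; direct sums over this finite set are
   finite functions on it. *)
Definition ltpair (n : nat) := {p : 'I_n * 'I_n | (p.1 < p.2)%N}.

Definition pairsum (n : nat) (R : pzRingType) : zmodType := {ffun ltpair n -> R}.

(* The parameter f is a phantom: it only determines the group law. *)
Definition N2 (n : nat) (R : pzRingType)
    (f : 'I_n -> sym_cocycle2 R (pairsum n R)) : Type :=
  ({ffun 'I_n -> R} * {ffun ltpair n -> R})%type.

Section GroupN2.
Variables (n : nat) (R : pzRingType) (f : 'I_n -> sym_cocycle2 R (pairsum n R)).

Definition N2_mul (a b : N2 f) : N2 f :=
  ([ffun i => a.1 i + b.1 i],
   [ffun p : ltpair n => a.2 p + b.2 p + a.1 (val p).1 * b.1 (val p).2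
              + \sum_(k < n) f k (a.1 k) (b.1 k) p]).

Definition N2_one : N2 f := ([ffun => 0], [ffun => 0]).

Definition N2_inv (a : N2 f) : N2 f :=
  ([ffun i => - a.1 i],
   [ffun p : ltpair n => - a.2 p + a.1 (val p).1 * a.1 (val p).2
              - \sum_(k < n) f k (a.1 k) (- a.1 k) p]).

Let f0x k x p : f k 0 x p = 0.
Proof. by case: (cocycle_funP (f k)) => -> _ _; rewrite ffunE. Qed.

Let fx0 k x p : f k x 0 p = 0.
Proof. by case: (cocycle_funP (f k)) => _ -> _; rewrite ffunE. Qed.

Let fD k x y z p :
  f k (x + y) z p + f k x y p = f k x (y + z) p + f k y z p.
Proof.
case: (cocycle_funP (f k)) => _ _ /(_ x y z) H.
by have := congr1 (fun h : {ffun ltpair n -> R} => h p) H; rewrite /= !ffunE.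
Qed.

Let shuffle (V : zmodType) (g1 g2 g3 t u v W X Y Z : V) : W + Y = Z + X ->
  g1 + (g2 + g3 + t + Y) + (u + v) + W = g1 + g2 + u + X + g3 + (v + t) + Z.
Proof.
move=> e; rewrite !addrA [LHS](ACl (1*2*3*4*6*7*(8*5))) /= e.
by rewrite [RHS](ACl (1*2*5*7*3*6*(8*4))).
Qed.

Lemma N2_mulA : associative N2_mul.
Proof.
move=> a b c; congr pair; apply/ffunP => p; rewrite !ffunE /=; first exact: addrA.
rewrite mulrDl mulrDr; apply: shuffle.
rewrite -!big_split; apply: eq_bigr => k _.
by rewrite /= !ffunE fD.
Qed.

Lemma N2_mul1g : left_id N2_one N2_mul.
Proof.
case=> a c; congr pair; apply/ffunP => p; rewrite !ffunE ?add0r //= mul0r addr0.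
by rewrite big1 ?addr0 // => k _; rewrite !ffunE f0x.
Qed.

Lemma N2_mulg1 : right_id N2_one N2_mul.
Proof.
case=> a c; congr pair; apply/ffunP => p; rewrite !ffunE ?addr0 //= mulr0 addr0.
by rewrite big1 ?addr0 // => k _; rewrite !ffunE fx0.
Qed.

Lemma N2_mulgV : right_inverse N2_one N2_inv N2_mul.
Proof.
case=> a c; congr pair; apply/ffunP => p; rewrite !ffunE /=; first exact: subrr.
rewrite mulrN; under [X in _ + X = _]eq_bigr => k _ do rewrite ffunE.
by rewrite !addrA [LHS](ACl ((1*2)*(3*5)*(4*6))) /= !subrr addNr !addr0.
Qed.

Lemma N2_mulVg : left_inverse N2_one N2_inv N2_mul.
Proof.
case=> a c; congr pair; apply/ffunP => p; rewrite !ffunE /=; first exact: addNr.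
rewrite mulNr; under [X in _ + X = _]eq_bigr => k _ do rewrite ffunE cocycle_symP.
by rewrite [LHS](ACl ((1*4)*(2*5)*(3*6))) /= addNr subrr addNr !addr0.
Qed.

HB.instance Definition _ := Choice.on (N2 f).
HB.instance Definition _ :=
  isGroup.Build (N2 f) N2_mulA N2_mul1g N2_mulg1 N2_mulVg N2_mulgV.

End GroupN2.

(* Main.v *)
Require Import Defs.
From mathcomp Require Import all_boot all_order all_algebra.
From HB Require Import structures.
From mathcomp Require Import ring.
From mathcomp Require Import boolp classical_sets functions filter.

(** Both groups are compared with the groups N_{2,n}(R) and N_{2,n}(S) whose
cocycles are zero.

N_{2,n}(R) is interpreted in the ring R: its elements are tuples of elements
of R and its operations are polynomial, so every group formula translates into
a ring formula (sat_interp), and R and S being elementarily equivalent,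
N_{2,n}(R) and N_{2,n}(S) are elementarily equivalent (untwisted_elem_equiv).

The comparison of N_{2,n}(R, f) with N_{2,n}(R) uses a nonprincipal
ultrafilter on the natural numbers. The cocycles f^1, ..., f^n form one
symmetric cocycle on R^n, and its ultrapower is a coboundary
(ultrapower_splits). Subtracting the function whose coboundary it is gives an
isomorphism between the ultrapowers of the two groups, which are therefore
elementarily equivalent by the theorem of Łoś (los_elem_equiv,
N2_elem_equiv_untwisted).

The ultrapower of the cocycle is a coboundary because its extension splits. In
characteristic zero the additive groups are torsion free, so the kernel of the
extension is a pure subgroup, and ultrapowers are countably saturated
(ultra_saturation), so this kernel is algebraically compact for countable
systems of congruences. Such a kernel has a complement (complement_exists): by
Zorn's lemma it is enough to enlarge a partial complement S with S + K pure by
an element above a given x. The element is chosen in the coset x + K so that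
it has, modulo S, all the divisors that x has modulo S + K (good_lift); these
are countably many congruences, any finitely many of which have a solution. *)

Set Implicit Arguments.
Unset Strict Implicit.
Unset Printing Implicit Defensive.
Import GRing.Theory.
Local Open Scope classical_set_scope.
Local Open Scope ring_scope.

(** * Complements of algebraically compact pure subgroups *)

Lemma bezout_cofactors q m : q != 0 ->
  exists a b d u v : int, [/\ q = a * d, m = b * d & u * a + v * b = 1].
Proof.
move=> q0; have [u [v uv]] := Bezoutz q m.
have d0 : gcdz q m != 0 by rewrite gcdz_eq0 negb_and q0.
exists (q %/ gcdz q m)%Z, (m %/ gcdz q m)%Z, (gcdz q m), u, v.
have eq : q = (q %/ gcdz q m)%Z * gcdz q m by rewrite divzK // dvdz_gcdl.
have em : m = (m %/ gcdz q m)%Z * gcdz q m by rewrite divzK // dvdz_gcdr.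
split=> //; apply: (mulIf d0).
by rewrite mulrDl -!mulrA -eq -em uv mul1r.
Qed.

Section Subgroups.
Variable M : zmodType.
Implicit Types (P S K N : set M) (x y e : M) (q m : int).

Lemma subrACA x y s t : (x - y) - (s - t) = (x - s) - (y - t).
Proof. by rewrite opprD addrACA -opprD. Qed.

Definition subgroup P := P 0 /\ forall x y, P x -> P y -> P (x - y).

Lemma subgN P x : subgroup P -> P x -> P (- x).
Proof. by move=> [P0 PB] Px; rewrite -sub0r; apply: PB. Qed.

Lemma subgD P x y : subgroup P -> P x -> P y -> P (x + y).
Proof.
by move=> sP Px Py; rewrite -[y]opprK; apply: sP.2 => //; apply: subgN.
Qed.

Lemma subgMz P x m : subgroup P -> P x -> P (x *~ m).
Proof.
move=> sP Px.
have PMn k : P (x *+ k).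
  by elim: k => [|k IH]; rewrite ?mulr0n ?mulrSr; [exact: sP.1 | exact: subgD].
by case: m => k; [exact: PMn | apply: subgN => //; exact: PMn].
Qed.

(** Purity is asked for all nonzero multipliers, so a subgroup is pure when
the quotient by it is torsion free. *)
Definition pure P := forall x q, q != 0 -> P (x *~ q) -> P x.

Definition sumset S K : set M := [set x | exists2 s, S s & K (x - s)].

Lemma sumset_subgroup S K : subgroup S -> subgroup K -> subgroup (sumset S K).
Proof.
move=> sS sK; split.
  by exists 0; [exact: sS.1 | rewrite subrr; exact: sK.1].
move=> x y [s Ss Kx] [t St Ky]; exists (s - t); first exact: sS.2.
by rewrite subrACA; apply: sK.2.
Qed.

Lemma sub_sumsetl S K : subgroup K -> S `<=` sumset S K.
Proof. by move=> sK s Ss; exists s => //; rewrite subrr; apply: sK.1. Qed.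

Lemma sub_sumsetr S K : subgroup S -> K `<=` sumset S K.
Proof. by move=> sS x Kx; exists 0; [exact: sS.1 | rewrite subr0]. Qed.

(** Divisibility by q in the quotient of M by P. *)
Definition dvdmod P q : set M := [set x | exists y, P (x - y *~ q)].

Lemma dvdmod_subgroup P q : subgroup P -> subgroup (dvdmod P q).
Proof.
move=> sP; split; first by exists 0; rewrite mul0rz subrr; exact: sP.1.
move=> x x' [y Py] [y' Py']; exists (y - y').
by rewrite mulrzBl subrACA; exact: sP.2.
Qed.

Lemma sub_dvdmod P q : P `<=` dvdmod P q.
Proof. by move=> x Px; exists 0; rewrite mul0rz subr0. Qed.

Lemma dvdmod_Mz P q x : subgroup P -> dvdmod P q (x *~ q).
Proof. by move=> sP; exists x; rewrite subrr; exact: sP.1. Qed.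

Lemma dvdmodMM P q m x :
  subgroup P -> dvdmod P q x -> dvdmod P (q * m) (x *~ m).
Proof.
by move=> sP [y Py]; exists y; rewrite mulrzA -mulrzBl; exact: subgMz.
Qed.

Lemma dvdmod_coprime P a b u v x : subgroup P -> u * a + v * b = 1 ->
  dvdmod P a (x *~ b) -> dvdmod P a x.
Proof.
move=> sP uv ax; have sD := dvdmod_subgroup a sP.
rewrite -[x]mulr1z -uv mulrzDr [v * b]mulrC !mulrzA; apply: subgD => //.
  by apply: dvdmod_Mz.
exact: subgMz.
Qed.

(** With q = a d, m = b d and u a + v b = 1, the element x = u a x + v b x is
divisible by a b d modulo P: multiply by a the divisibility by m = b d, and by
b the divisibility by q = a d. *)
Lemma dvdmod_lcm P q m x : subgroup P -> q != 0 ->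
  dvdmod P q x -> dvdmod P m x ->
  exists l k, dvdmod P (q * l) x /\ q * l = m * k.
Proof.
move=> sP q0 qx mx.
have [a [b [d [u [v [eq em uv]]]]]] := bezout_cofactors m q0.
subst q m.
exists b, a; split; last by ring.
rewrite -[x]mulr1z -uv mulrzDr; have sD := dvdmod_subgroup (a * d * b) sP.
apply: subgD => //.
  have -> : u * a = a * u by ring.
  rewrite mulrzA; apply: subgMz => //.
  have -> : a * d * b = b * d * a by ring.
  exact: dvdmodMM.
have -> : v * b = b * v by ring.
by rewrite mulrzA; apply: subgMz => //; exact: dvdmodMM.
Qed.

End Subgroups.

Section Complement.
Variables (M : zmodType) (N K : set M).
Hypotheses (sN : subgroup N) (sK : subgroup K) (NK : N `<=` K).
Hypotheses (pN : pure N) (pK : pure K).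
(** Algebraic compactness of K / N for countable systems of congruences in one
unknown. *)
Hypothesis compactK : forall (g : nat -> int) (x : nat -> M),
  (forall k, exists2 a, K a &
     forall j, (j <= k)%N -> dvdmod N (g j) (a + x j)) ->
  exists2 a, K a & forall j, dvdmod N (g j) (a + x j).

(** Modulo N, such an S is a complement of K in a subgroup S + K with
torsion-free quotient; purity of S + K is what allows S to be enlarged. *)
Definition partial_complement (S : set M) :=
  [/\ subgroup S, N `<=` S, S `&` K `<=` N & pure (sumset S K)].

Section Extension.
Variables (S : set M) (x : M).
Hypotheses (cS : partial_complement S) (xS : ~ sumset S K x).

Let P := sumset S K.
Let sS : subgroup S. Proof. by case: cS. Qed.
Let NS : N `<=` S. Proof. by case: cS. Qed.
Let SKN s : S s -> K s -> N s.
Proof. by move=> Ss Ks; case: cS => _ _ + _; apply. Qed.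
Let pP : pure P. Proof. by case: cS. Qed.
Let sP : subgroup P. Proof. exact: sumset_subgroup. Qed.
Let SP : S `<=` P. Proof. exact: sub_sumsetl. Qed.
Let KP : K `<=` P. Proof. exact: sub_sumsetr. Qed.

(** A divisibility that holds in M / K lifts to S, because S is isomorphic
modulo N to its image in M / K, and that image is pure. *)
Lemma dvdmod_kernel s q : S s -> dvdmod K q s -> dvdmod N q s.
Proof.
move=> Ss [z Kz]; have [q0|q0] := eqVneq q 0.
  by exists 0; rewrite mul0rz subr0; apply: SKN => //; rewrite q0 subr0 in Kz.
have [t St Kzt] : P z.
  apply: (pP q0); rewrite -[z *~ q](subKr s).
  by apply: sP.2; [exact: SP | exact: KP].
exists t; apply: SKN; first by apply: sS.2 => //; exact: subgMz.
have -> : s - t *~ q = (s - z *~ q) + (z - t) *~ q.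
  by rewrite mulrzBl addrA subrK.
by apply: subgD => //; exact: subgMz.
Qed.

Lemma common_multiple (g : nat -> int) k : (forall j, dvdmod P (g j) x) ->
  exists q, dvdmod P q x /\ forall j, (j <= k)%N -> exists l, q = g j * l.
Proof.
move=> gP; elim: k => [|k [q [qx qg]]].
  exists (g 0%N); split=> // j; rewrite leqn0 => /eqP->.
  by exists 1; rewrite mulr1.
have q0 : q != 0.
  by apply: contra_notN xS => /eqP q0; case: qx => y; rewrite q0 subr0.
have [l [r [qlx ql]]] := dvdmod_lcm sP q0 qx (gP k.+1).
exists (q * l); split=> // j.
rewrite leq_eqVlt => /predU1P[->|]; first by exists r.
by rewrite ltnS => /qg[r' ->]; exists (r' * l); rewrite mulrA.
Qed.

(** The coset x + K contains an element e that satisfies at once, modulo S,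
every divisibility that x satisfies modulo S + K. For each q these
divisibilities ask for the congruence e = s modulo q M + N with one s in S,
the others following by dvdmod_kernel; so there are countably many of them,
and finitely many are solved by lifting the divisibility of x by a common
multiple. *)
Lemma good_lift : exists2 e, K (e - x) &
  forall q, dvdmod P q x -> exists2 s, S s & dvdmod N q (e - s).
Proof.
(* The integers are enumerated through their codes; 1 always divides x, which
   makes it a neutral value where the code gives no divisor of x. *)
pose g j : int :=
  if @unpickle int j is Some q then if `[< dvdmod P q x >] then q else 1 else 1.
have gP j : dvdmod P (g j) x.
  have P1 : dvdmod P 1 x by exists x; rewrite mulr1z subrr; exact: sP.1.
  by rewrite /g; case: unpickle => // q; case: asboolP.
have /choice[s sP'] j : exists s, S s /\ dvdmod K (g j) (x - s).
  have [y [s Ss Kys]] := gP j; exists s; split=> //; exists y.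
  by rewrite addrAC.
have [k|a Ka aN] := @compactK g (fun j => x - s j).
  have [q [qx qg]] := common_multiple k gP.
  have [y [t St Kyt]] := qx.
  exists (- (x - y *~ q - t)); first exact: subgN.
  move=> j /qg[l ql].
  have -> : - (x - y *~ q - t) + (x - s j) = y *~ q + (t - s j).
    by rewrite !opprB !addrA subrK [t + _]addrC.
  have sD := dvdmod_subgroup (g j) sN.
  apply: subgD => //; first by rewrite ql mulrC mulrzA; exact: dvdmod_Mz.
  apply: dvdmod_kernel; first by apply: sS.2 => //; case: (sP' j).
  have -> : t - s j = (x - s j) - (x - t).
    by rewrite opprB [RHS]addrC addrA subrK.
  apply: (dvdmod_subgroup _ sK).2; first by case: (sP' j).
  by exists (y *~ l); rewrite -mulrzA [l * _]mulrC -ql addrAC.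
exists (a + x); first by rewrite addrK.
move=> q qx; exists (s (pickle q)); first by case: (sP' (pickle q)).
by have := aN (pickle q); rewrite /g pickleK asboolT // addrA.
Qed.

(** The enlarged subgroup S' is the pure hull of S + Z e, for e as in
good_lift. It meets K in N only because no nonzero multiple of e lies in S +
K. For the purity of S' + K, a relation between y and e modulo S + K can be
divided until it reads a y = b e with a, b coprime; then a divides x modulo S
+ K, so it divides e modulo S, with a quotient z in S', and y = b z modulo S +
K. *)
Lemma partial_complement_extend :
  exists S', [/\ partial_complement S', S `<=` S' & ~ S' `<=` S].
Proof.
have [e Kex eN] := good_lift.
have Pxm m : P (e *~ m) -> m = 0.
  move=> Pem; apply: contra_notP xS => /eqP m0; apply: (pP m0).
  rewrite -[x](subKr e) mulrzBl; apply: sP.2 => //.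
  by apply: subgMz => //; exact: KP.
pose S' : set M := [set y | exists q m, q != 0 /\ S (y *~ q - e *~ m)].
have SS' : S `<=` S' by move=> s Ss; exists 1, 0; rewrite mulr1z mulr0z subr0.
have sS' : subgroup S'.
  split; first by apply: SS'; exact: sS.1.
  move=> y y' [q [m [q0 Sy]]] [q' [m' [q'0 Sy']]].
  exists (q * q'), (m * q' - m' * q); split; first by rewrite mulf_neq0.
  have -> : (y - y') *~ (q * q') - e *~ (m * q' - m' * q)
          = (y *~ q - e *~ m) *~ q' - (y' *~ q' - e *~ m') *~ q.
    by rewrite !mulrzBl mulrzBr -!mulrzA [q' * q]mulrC subrACA.
  by apply: sS.2; exact: subgMz.
exists S'; split=> //; last first.
  move=> S'S; apply: xS; exists e; last by rewrite -opprB; exact: subgN.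
  by apply: S'S; exists 1, 1; rewrite subrr; split=> //; exact: sS.1.
split=> //; first by move=> y /NS/SS'.
  move=> y [[q [m [q0 Sy]]] Ky]; apply: (pN q0); apply: SKN; last exact: subgMz.
  suff m0 : m = 0 by move: Sy; rewrite m0 mulr0z subr0.
  apply: Pxm; rewrite -[e *~ m](subKr (y *~ q)).
  by apply: sP.2; [apply: KP; exact: subgMz | exact: SP].
move=> y q q0 [t [r [m [r0 Str]]] Kyt].
have PP' : P `<=` sumset S' K by move=> z [s /SS' ? ?]; exists s.
have sP' : subgroup (sumset S' K) by exact: sumset_subgroup.
have qr0 : q * r != 0 by rewrite mulf_neq0.
have Py : P (y *~ (q * r) - e *~ m).
  have -> : y *~ (q * r) - e *~ m = (y *~ q - t) *~ r + (t *~ r - e *~ m).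
    by rewrite mulrzBl mulrzA addrA subrK.
  by apply: subgD; [|apply: KP; exact: subgMz | exact: SP].
have [a [b [d [u [v [eqr em uv]]]]]] := bezout_cofactors m qr0.
move: qr0 Py; rewrite {}eqr {}em mulf_eq0 negb_or => /andP[a0 d0].
rewrite !mulrzA -mulrzBl => /(pP d0) Py.
have /eN[s Ss [z Nz]] : dvdmod P a x.
  rewrite -[x](subKr e); apply: (dvdmod_subgroup _ sP).2.
    apply: (dvdmod_coprime sP uv); exists y; rewrite -opprB; exact: subgN.
  by apply: sub_dvdmod; exact: KP.
have Sez : S (e - z *~ a).
  by rewrite -(subrK s e) addrAC; apply: subgD => //; exact: NS.
have S'z : S' z by exists a, 1; split=> //; rewrite mulr1z -opprB; exact: subgN.
rewrite -(subrK (z *~ b) y); apply: subgD => //; last first.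
  by apply: sub_sumsetl => //; exact: subgMz.
apply: PP'; apply: (pP a0).
have -> : (y - z *~ b) *~ a = (y *~ a - e *~ b) + (e - z *~ a) *~ b.
  by rewrite !mulrzBl addrA subrK -!mulrzA mulrC.
by apply: subgD => //; apply: subgMz => //; exact: SP.
Qed.

End Extension.

(** A torsion-free quotient splits off a subgroup K / N which is algebraically
compact: by Zorn's lemma there is a maximal partial complement, and by
partial_complement_extend it cannot miss any element of M. *)
Theorem complement_exists :
  exists S, [/\ subgroup S, N `<=` S, S `&` K `<=` N & forall x, sumset S K x].
Proof.
have NKK : sumset N K = K.
  apply/seteqP; split=> [x [n /NK Kn Kx]|]; last exact: sub_sumsetr.
  by rewrite -(subrK n x); exact: subgD.
have cN : partial_complement N by split=> //; rewrite NKK.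
(* Adding N to the members makes the empty chain harmless. *)
pose Q : set (set M) := [set X | partial_complement (X `|` N)].
have [F FQ totF|S [cS Smax]] := @Zorn_bigcup M Q.
  set B := \bigcup_(X in F) X.
  have BN x y : (B `|` N) x -> (B `|` N) y -> exists X,
      [/\ partial_complement X, X `<=` B `|` N, X x & X y].
    have inF X : F X -> X `|` N `<=` B `|` N.
      by move=> FX z [Xz|Nz]; [left; exists X | right].
    have one X : F X -> partial_complement (X `|` N) by move=> /FQ.
    move=> [[X FX Xx]|Nx] [[Y FY Yy]|Ny].
    - have [XY|YX] := totF _ _ FX FY.
        exists (Y `|` N).
        by split; [exact: one | exact: inF | left; exact: XY | left].
      exists (X `|` N).
      by split; [exact: one | exact: inF | left | left; exact: YX].
    - by exists (X `|` N); split; [exact: one | exact: inF | left | right].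
    - by exists (Y `|` N); split; [exact: one | exact: inF | right | left].
    - by exists N; split=> //; right.
  split=> //; last 1 first.
  - move=> x q q0 [s Bs Kxs].
    have [X [[_ _ _ pX] XB Xs _]] := BN _ _ Bs Bs.
    have [t Xt Kxt] : sumset X K x by apply: (pX _ _ q0); exists s.
    by exists t => //; exact: XB.
  - split=> [|x y Bx By]; first by right; exact: sN.1.
    by have [X [[sX _ _ _] XB Xx Xy]] := BN _ _ Bx By; apply: XB; exact: sX.2.
  - move=> x [Bx Kx]; have [X [[_ _ XKN _] _ Xx _]] := BN _ _ Bx Bx.
    exact: XKN.
have [sS NS SKN _] := cS.
exists (S `|` N); split=> // x; apply: contrapT => xS.
have [S' [cS' SS' S'S]] := partial_complement_extend cS xS.
apply: (Smax S').
  split; first by move=> z Sz; apply: SS'; left.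
  by move=> S'S0; apply: S'S => z /S'S0 Sz; left.
by rewrite /Q /= (_ : S' `|` N = S') //; apply: setUidl; case: cS'.
Qed.

End Complement.

(** * Ultrafilters and elementary equivalence *)

Lemma nonprincipal_ultrafilter :
  exists U : set_system nat, UltraFilter U /\ forall k, U [set i | (k <= i)%N].
Proof.
have [U [uU ooU]] := @ultraFilterLemma _ (\oo : set_system nat) _.
by exists U; split=> // k; apply: ooU; exists k.
Qed.

Section Ultra.
Variables (I : Type) (U : set_system I).
Hypothesis uU : UltraFilter U.

Lemma ultra_imp (A B : set I) :
  (U A -> U B) <-> U [set i | A i -> B i].
Proof.
split=> [AB | UAB UA]; last by apply: filterS2 UAB UA.
have [UA|UnA] := in_ultra_setVsetC A uU.
  by apply: filterS (AB UA) => i Bi _.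
by apply: filterS UnA => i nAi /nAi.
Qed.

(** From right to left, apply the right-hand side to a choice of
counterexamples. *)
Lemma ultra_forall (A : Type) (P : I -> A -> Prop) :
  U [set i | forall a, P i a] <-> forall a : I -> A, U [set i | P i (a i)].
Proof.
split=> [UP a|UP]; first by apply: filterS UP => i; apply.
have [[a0 _]|noA] := pselect (exists a : A, True); last first.
  by apply: filterE => i a; case: noA; exists a.
have /choice[a aP] i : exists a, P i a -> forall b, P i b.
  have [allP|/existsNP[b nPb]] := pselect (forall b, P i b); first by exists a0.
  by exists b.
by apply: filterS (UP a) => i /aP.
Qed.

Lemma ultra_not0 : ~ U set0.
Proof. exact: filter_not_empty. Qed.

End Ultra.

(** The relation E stands for an isomorphism between the ultrapowers of M and
N; it is kept on sequences so that no quotient needs to be formed. *)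
Section Los.
Variables (L : language) (M N : structure L) (I : Type) (U : set_system I).
Hypothesis uU : UltraFilter U.
Variable E : (I -> M) -> (I -> N) -> Prop.
Hypothesis E_total : forall a, exists b, E a b.
Hypothesis E_surj : forall b, exists a, E a b.
Hypothesis E_eq : forall a a' b b', E a b -> E a' b' ->
  U [set i | a i = a' i] <-> U [set i | b i = b' i].
Hypothesis E_fun : forall (s : funsym L) (a : 'I_(fun_arity s) -> I -> M) b,
  (forall j, E (a j) (b j)) ->
  E (fun i => fun_interp M s (a ^~ i)) (fun i => fun_interp N s (b ^~ i)).
Hypothesis E_rel : forall (r : relsym L) (a : 'I_(rel_arity r) -> I -> M) b,
  (forall j, E (a j) (b j)) ->
  U [set i | rel_interp M r (a ^~ i)] <-> U [set i | rel_interp N r (b ^~ i)].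

Lemma eval_correspondence (v : nat -> I -> M) (w : nat -> I -> N) t :
  (forall x, E (v x) (w x)) ->
  E (fun i => eval (v ^~ i) t) (fun i => eval (w ^~ i) t).
Proof. by move=> vw; elim: t => [x|s ts IH] /=; [exact: vw | exact: E_fun]. Qed.

(** The induction of Łoś's theorem, run for both ultrapowers at once:
quantifiers are matched because E is total and surjective. *)
Lemma sat_correspondence phi (v : nat -> I -> M) (w : nat -> I -> N) :
  (forall x, E (v x) (w x)) ->
  U [set i | sat (v ^~ i) phi] <-> U [set i | sat (w ^~ i) phi].
Proof.
elim: phi v w => [|t u|r ts|p IHp q IHq|x p IHp] v w vw //=.
- by apply: E_eq; exact: eval_correspondence.
- by apply: E_rel => j; exact: eval_correspondence.
- by rewrite -!ultra_imp; split=> pq; move/(IHp _ _ vw)/pq/(IHq _ _ vw).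
have updE (A : structure L) (z : nat -> I -> A) a :
    [set i | sat (update (z ^~ i) x (a i)) p]
    = [set i | sat (fun y => (if y == x then a else z y) i) p].
  apply/funext => i; congr (sat _ p); apply/funext => y.
  by rewrite /update; case: eqP.
have vwx a b : E a b -> forall y,
    E (if y == x then a else v y) (if y == x then b else w y).
  by move=> ab y; case: eqP.
rewrite !ultra_forall; split=> satp.
  move=> b; have [a ab] := E_surj b; have := satp a.
  by rewrite !updE => /(IHp _ _ (vwx _ _ ab)).
move=> a; have [b ab] := E_total a; have := satp b.
by rewrite !updE => /(IHp _ _ (vwx _ _ ab)).
Qed.

(** A valuation in one structure is a constant family of valuations, to which
sat_correspondence gives a family in the other structure. *)
Lemma los_elem_equiv : elem_equiv M N.
Proof.
move=> phi _; split=> Mphi.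
  move=> w; have /choice[v vw] x := E_surj (fun=> w x).
  have /(sat_correspondence phi) [+ _] := vw.
  have UM : U [set i | sat (v ^~ i) phi] by apply: filterE => i; exact: Mphi.
  move=> /(_ UM) UN; apply: contrapT => nw; apply: (ultra_not0 uU).
  by apply: filterS UN => i.
move=> v; have /choice[w vw] x := E_total (fun=> v x).
have /(sat_correspondence phi) [_ +] := vw.
have UN : U [set i | sat (w ^~ i) phi] by apply: filterE => i; exact: Mphi.
move=> /(_ UN) UM; apply: contrapT => nv; apply: (ultra_not0 uU).
by apply: filterS UM => i.
Qed.

End Los.

Section Saturation.
Variable U : set_system nat.
Hypothesis uU : UltraFilter U.
Hypothesis Uoo : forall k, U [set i | (k <= i)%N].

(** Ultrapowers over a nonprincipal ultrafilter on nat are countably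
saturated. At the index i, t satisfies as long an initial segment of the first
i + 1 conditions as possible; this covers the condition j at almost all i >=
j. *)
Lemma ultra_saturation (T : Type) (Q : nat -> nat -> T -> Prop) :
  (forall k, U [set i | exists t, forall j, (j <= k)%N -> Q j i t]) ->
  exists t : nat -> T, forall j, U [set i | Q j i (t i)].
Proof.
move=> UQ.
have [_ [t0 _]] := filter_ex (UQ 0%N).
have best i m : exists t, forall k, (k < m)%N ->
    (exists s, forall j, (j <= k)%N -> Q j i s) ->
    forall j, (j <= k)%N -> Q j i t.
  elim: m => [|m [t tm]]; first by exists t0.
  have [[s sm]|nsm] := pselect (exists s, forall j, (j <= m)%N -> Q j i s).
    by exists s => k km _ j jk; apply: sm; exact: leq_trans jk km.
  exists t => k; rewrite ltnS leq_eqVlt => /predU1P[->//|]; exact: tm.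
have /choice[t tP] i := best i i.+1.
exists t => j; apply: filterS2 (Uoo j) (UQ j) => i ji Qi.
exact: (tP i j).
Qed.

End Saturation.

(** * Abelian extensions and their ultrapowers *)

Section Extension.
Variables (B A : zmodType) (f : sym_cocycle2 B A).

(** The abelian extension of B by A with cocycle f, which only determines the
addition. *)
Definition cocycle_ext (f : sym_cocycle2 B A) : Type := (B * A)%type.
Local Notation E := (cocycle_ext f).

HB.instance Definition _ := Choice.on E.

Definition ext_add (x y : E) : E := (x.1 + y.1, x.2 + y.2 + f x.1 y.1).
Definition ext_opp (x : E) : E := (- x.1, - x.2 - f x.1 (- x.1)).

Fact ext_addA : associative ext_add.
Proof.
move=> x y z; congr pair => /=; first exact: addrA.
have [_ _ fD] := cocycle_funP f.
by rewrite [RHS](ACl (1*2*4*(5*3))) /= fD [f x.1 _ + _]addrC !addrA.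
Qed.

Fact ext_addC : commutative ext_add.
Proof.
by move=> x y; rewrite /ext_add cocycle_symP [x.1 + _]addrC [x.2 + _]addrC.
Qed.

Fact ext_add0 : left_id (0, 0) ext_add.
Proof.
have [f0 _ _] := cocycle_funP f.
by case=> b a; rewrite /ext_add /= f0 !add0r addr0.
Qed.

Fact ext_addN : left_inverse (0, 0) ext_opp ext_add.
Proof.
move=> x; rewrite ext_addC /ext_add /= subrr; congr pair.
by rewrite addrA subrr sub0r addNr.
Qed.

HB.instance Definition _ :=
  GRing.isZmodule.Build E ext_addA ext_addC ext_add0 ext_addN.

Definition ext_proj (x : E) : B := x.1.

Fact ext_proj_is_additive : zmod_morphism ext_proj.
Proof. by []. Qed.

HB.instance Definition _ :=
  GRing.isZmodMorphism.Build E B ext_proj ext_proj_is_additive.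

Definition ext_inj (a : A) : E := (0, a).

Fact ext_inj_is_additive : zmod_morphism ext_inj.
Proof.
have [f0 _ _] := cocycle_funP f.
by move=> a a'; congr pair; rewrite /= ?subr0 // !f0 !subr0 addr0.
Qed.

HB.instance Definition _ :=
  GRing.isZmodMorphism.Build A E ext_inj ext_inj_is_additive.

End Extension.

Definition torsion_free (V : zmodType) :=
  forall (x : V) (q : int), q != 0 -> x *~ q = 0 -> x = 0.

Lemma ext_torsion_free (B A : zmodType) (f : sym_cocycle2 B A) :
  torsion_free B -> torsion_free A -> torsion_free (cocycle_ext f).
Proof.
move=> tfB tfA [b a] q q0 xq0.
have b0 : b = 0.
  apply: (tfB b q q0).
  by have := congr1 (@ext_proj _ _ f) xq0; rewrite raddfMz raddf0.
move: xq0; rewrite b0 -[(0, a)]/(ext_inj f a) -raddfMz => -[/(tfA _ _ q0) ->].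
by [].
Qed.

Section Ultrapower.
Variable U : set_system nat.
Hypothesis uU : UltraFilter U.
Hypothesis Uoo : forall k, U [set i | (k <= i)%N].

(** The sequences that phi maps to 0 in the ultrapower of W. For phi the
identity these are the sequences that vanish in the ultrapower of V. *)
Definition ultra_kernel (V W : zmodType) (phi : V -> W) : set (nat -> V) :=
  [set x | U [set i | phi (x i) = 0]].

Lemma ultra_kernel_subgroup (V W : zmodType) (phi : {additive V -> W}) :
  subgroup (ultra_kernel phi).
Proof.
split=> [|x y]; first by apply: filterE => i; exact: raddf0.
move=> xK yK; apply: filterS2 xK yK => i xi yi.
by change (phi (x i - y i) = 0); rewrite raddfB xi yi subrr.
Qed.

Lemma fct_mulrz (V : zmodType) (x : nat -> V) q i : (x *~ q) i = x i *~ q.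
Proof.
have natE n : (x *+ n) i = x i *+ n.
  by elim: n => [|n IH]; rewrite ?mulr0n // !mulrS -IH.
by case: q => n; [exact: natE | congr (- _); exact: natE].
Qed.

Lemma ultra_kernel_pure (V W : zmodType) (phi : {additive V -> W}) :
  torsion_free W -> pure (ultra_kernel phi).
Proof.
move=> tfW x q q0; apply: filterS => i /=.
by rewrite fct_mulrz raddfMz; exact: tfW.
Qed.

(** Modulo N, divisibility by a fixed integer is decided index by index, so
the congruences become conditions on the entries of a. *)
Lemma ultra_kernel_compact (V W : zmodType) (phi : V -> W)
    (g : nat -> int) (x : nat -> nat -> V) :
  let N := ultra_kernel (@idfun V) in let K := ultra_kernel phi in
  (forall k, exists2 a, K a &
     forall j, (j <= k)%N -> dvdmod N (g j) (a + x j)) ->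
  exists2 a, K a & forall j, dvdmod N (g j) (a + x j).
Proof.
move=> N K fin.
pose Q j i (a : V) := phi a = 0 /\ exists y, a + x j i = y *~ g j.
have [|a aQ] := @ultra_saturation U uU Uoo V Q.
  move=> k; have [a Ka aN] := fin k.
  have aNk : U [set i | forall j, (j < k.+1)%N ->
      exists y, a i + x j i = y *~ g j].
    elim: k.+1 (fun j => aN j : (j < k.+1)%N -> _) => [_|m IH amN].
      by apply: filterE => i [].
    have [y Ny] := amN m (ltnSn m).
    have := IH (fun j jm => amN j (ltnW jm)); apply: filterS2 Ny => i yi IHi j.
    rewrite ltnS leq_eqVlt => /predU1P[->|/IHi//]; exists (y i).
    by apply/eqP; rewrite -subr_eq0 -fct_mulrz; apply/eqP.
  by apply: filterS2 Ka aNk => i ai ji; exists (a i) => j /ji.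
exists a; first by apply: filterS (aQ 0%N) => i [].
move=> j; have /choice[y yP] i :
    exists y, Q j i (a i) -> a i + x j i = y *~ g j.
  by have [[_ [y]]|nQ] := pselect (Q j i (a i)); [exists y | exists 0].
exists y; apply: filterS (aQ j) => i /yP /= yi.
by rewrite -[_ i]/(a i + x j i - (y *~ g j) i) yi fct_mulrz subrr.
Qed.

(** In the ultrapower of the extension of B by A, the ultrapower of A has a
complement S; the second component of the element of S above x is h x. *)
Theorem ultrapower_splits (B A : zmodType) (f : sym_cocycle2 B A) :
  torsion_free B -> torsion_free A ->
  exists h : (nat -> B) -> nat -> A,
    (forall x y, U [set i | x i = y i] -> U [set i | h x i = h y i]) /\
    forall x y, U [set i | h (x + y) i = h x i + h y i + f (x i) (y i)].
Proof.
move=> tfB tfA; pose E := cocycle_ext f.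
pose N := ultra_kernel (@idfun E); pose K := ultra_kernel (@ext_proj _ _ f).
have sN : subgroup N by exact: ultra_kernel_subgroup.
have sK : subgroup K by exact: ultra_kernel_subgroup.
have NK : N `<=` K by move=> x; apply: filterS => i /= ->.
have [|||S [sS NS SKN SK]] := complement_exists sN sK NK.
- by apply: ultra_kernel_pure; exact: ext_torsion_free.
- exact: ultra_kernel_pure.
- move=> g x; exact: ultra_kernel_compact.
pose lift (x : nat -> B) (a : nat -> A) : nat -> E := fun i => (x i, a i).
have /choice[h hS] (x : nat -> B) : exists a, S (lift x a).
  have [s Ss Ks] := SK (lift x 0); exists (fun i => (s i).2).
  rewrite -(subrK s (lift _ _)); apply: (subgD sS) => //; apply: NS.
  apply: filterS Ks => i Ki.
  have {Ki} /eqP : ext_proj (lift x 0 i - s i) = 0 by [].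
  rewrite raddfB subr_eq0 => /eqP /= xs.
  change (((x i, (s i).2) : E) - s i = 0).
  have -> : x i = (s i).1 by [].
  by rewrite -surjective_pairing subrr.
have unique (x y : nat -> B) a b : U [set i | x i = y i] ->
    S (lift x a) -> S (lift y b) -> U [set i | a i = b i].
  move=> xy Sxa Syb; have : N (lift x a - lift y b).
    apply: SKN; split; first exact: sS.2.
    apply: filterS xy => i /= xyi.
    by change (x i - y i = 0); rewrite xyi subrr.
  apply: filterS => i Ni; have {Ni} /eqP : lift x a i - lift y b i = 0 by [].
  by rewrite subr_eq0 => /eqP[].
exists h; split=> x y; first by move=> xy; exact: (unique x y).
apply: (unique (x + y) (x + y)) => //; first by apply: filterE.
exact: (subgD sS (hS x) (hS y)).
Qed.

End Ultrapower.

(** * Removing the cocycles *)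

Lemma ffun_mulrz (T : finType) (V : zmodType) (x : {ffun T -> V}) q t :
  (x *~ q) t = x t *~ q.
Proof. by case: q => k /=; rewrite -?pmulrn ?NegzE ?mulrNz ?ffunE ?ffunMnE. Qed.

Lemma torsion_free_ffun (T : finType) (V : zmodType) :
  torsion_free V -> torsion_free {ffun T -> V}.
Proof.
move=> tfV x q q0 xq0; apply/ffunP => t; rewrite ffunE; apply: (tfV _ q q0).
by rewrite -ffun_mulrz xq0 ffunE.
Qed.

Lemma char0_torsion_free (R : idomainType) :
  [pchar R] =i pred0 -> torsion_free R.
Proof.
move=> R0 x q q0 /eqP; rewrite -mulrzr mulf_eq0 => /orP[/eqP//|].
have natR k : (0 < k)%N -> k%:R == 0 :> R = false.
  move=> k0; apply/negP => /(natf0_pchar k0)[p].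
  by rewrite R0.
case: q q0 => k /= k0.
  by rewrite -pmulrn natR // lt0n.
by rewrite NegzE mulrNz oppr_eq0 -pmulrn natR.
Qed.

Section ZeroCocycle.
Variables (B A : zmodType).

Fact cocycle0P : cocycle2 (fun _ _ : B => 0 : A).
Proof. by split. Qed.

Definition cocycle0 : sym_cocycle2 B A :=
  SymCocycle2 cocycle0P (fun _ _ => erefl).

End ZeroCocycle.

Section Untwist.
Variables (n : nat) (R : idomainType).
Variable f : 'I_n -> sym_cocycle2 R (pairsum n R).

(** The cocycles f^k act on separate coordinates; together they are one
cocycle on R^n, so that a single splitting removes them all. *)
Definition total_cocycle_fun (a b : {ffun 'I_n -> R}) : pairsum n R :=
  \sum_(k < n) f k (a k) (b k).

Fact total_cocycleP : cocycle2 total_cocycle_fun.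
Proof.
split=> [x|x|x y z]; rewrite /total_cocycle_fun.
- by apply: big1 => k _; rewrite ffunE; case: (cocycle_funP (f k)).
- by apply: big1 => k _; rewrite ffunE; case: (cocycle_funP (f k)).
rewrite -!big_split; apply: eq_bigr => k _ /=; rewrite !ffunE.
by case: (cocycle_funP (f k)).
Qed.

Fact total_cocycle_sym x y : total_cocycle_fun x y = total_cocycle_fun y x.
Proof. by apply: eq_bigr => k _; rewrite cocycle_symP. Qed.

Definition total_cocycle : sym_cocycle2 {ffun 'I_n -> R} (pairsum n R) :=
  SymCocycle2 total_cocycleP total_cocycle_sym.

Definition mixed (a b : {ffun 'I_n -> R}) : pairsum n R :=
  [ffun p : ltpair n => a (val p).1 * b (val p).2].

Lemma N2_mulE (a b : N2 f) : (a * b)%g =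
  (a.1 + b.1, a.2 + b.2 + mixed a.1 b.1 + total_cocycle a.1 b.1) :> N2 f.
Proof.
by congr pair; apply/ffunP => p; rewrite !ffunE //= sum_ffunE.
Qed.

Lemma N2_invE (a : N2 f) : (a^-1)%g =
  (- a.1, - a.2 + mixed a.1 a.1 - total_cocycle a.1 (- a.1)) :> N2 f.
Proof.
congr pair; apply/ffunP => p; rewrite !ffunE //= sum_ffunE.
by congr (_ - _); apply: eq_bigr => k _; rewrite ffunE.
Qed.

Lemma N2_oneE : (1 : N2 f)%g = (0, 0) :> N2 f.
Proof. by congr pair; apply/ffunP => p; rewrite !ffunE. Qed.

End Untwist.

Arguments total_cocycle {n R} f : simpl never.

Definition N2_untwisted n (R : pzRingType) :=
  N2 (fun _ : 'I_n => cocycle0 R (pairsum n R)).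

Lemma total_cocycle0 n (R : idomainType) (a b : {ffun 'I_n -> R}) :
  total_cocycle (fun _ => cocycle0 R (pairsum n R)) a b = 0.
Proof. by apply: big1. Qed.

(** If h splits the total cocycle in the ultrapower, then the map tw that
sends (alpha, gamma) to (alpha, gamma - h alpha) is an isomorphism from the
ultrapower of N_{2,n}(R, f) onto that of the group with zero cocycles. *)
Theorem N2_elem_equiv_untwisted n (R : idomainType)
    (f : 'I_n -> sym_cocycle2 R (pairsum n R)) :
  [pchar R] =i pred0 ->
  elem_equiv (group_structure (N2 f)) (group_structure (N2_untwisted n R)).
Proof.
move=> /char0_torsion_free tfR; set G := N2 f; set H := N2_untwisted n R.
have [U [uU Uoo]] := nonprincipal_ultrafilter.
have [h [hext hD]] := @ultrapower_splits U uU Uoo _ _ (total_cocycle f)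
  (torsion_free_ffun tfR) (torsion_free_ffun tfR).
pose proj1 T (a : nat -> {ffun 'I_n -> R} * T) i := (a i).1.
pose tw (a : nat -> G) i : H := ((a i).1, (a i).2 - h (proj1 _ a) i).
have h0 : U [set i | h 0 i = 0].
  have [f0 _ _] := cocycle_funP (total_cocycle f).
  apply: filterS (hD 0 0) => i.
  rewrite /mkset addr0 [total_cocycle f _ _]f0 addr0 => e.
  by apply: (addrI (h 0 i)); rewrite -e addr0.
have twM a b : U [set i | (tw a i * tw b i)%g = tw (fun j => a j * b j)%g i].
  apply: filterS (hD (proj1 _ a) (proj1 _ b)) => i; rewrite /mkset => hab.
  rewrite /tw !N2_mulE total_cocycle0.
  have -> : proj1 _ (fun j => a j * b j)%g = proj1 _ a + proj1 _ b.
    by apply/funext => j; rewrite /proj1 N2_mulE.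
  congr pair; rewrite hab addr0 opprD [RHS]addrACA subrr addr0.
  by rewrite /= opprD [RHS]addrAC [X in _ = X + _]addrACA.
have twV a : U [set i | (tw a i)^-1%g = tw (fun j => (a j)^-1)%g i].
  have := hD (proj1 _ a) (- proj1 _ a); rewrite subrr => hN.
  apply: filterS2 h0 hN => i; rewrite /mkset => -> /esym hN.
  rewrite /tw !N2_invE total_cocycle0.
  have -> : proj1 _ (fun j => (a j)^-1)%g = - proj1 _ a.
    by apply/funext => j; rewrite /proj1 N2_invE.
  congr pair; rewrite /= subr0 opprB -[RHS]addrA -opprD.
  have -> : - (total_cocycle f (a i).1 (- (a i).1) + h (- proj1 _ a) i)
            = h (proj1 _ a) i.
    by apply/esym/eqP; rewrite -addr_eq0 addrCA addrC; apply/eqP.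
  by rewrite [RHS]addrAC [- _ + _]addrC.
pose E (a : nat -> G) (b : nat -> H) : Prop := U [set i | b i = tw a i].
apply: (@los_elem_equiv _ (group_structure G) (group_structure H) _ U uU E).
- by move=> a; exists (tw a); apply: filterE.
- move=> b; exists (fun i => ((b i).1, (b i).2 + h (proj1 _ b) i)).
  by apply: filterE => i; rewrite /tw /= addrK -surjective_pairing.
- move=> a a' b b' Eab Eab'; split=> eqi.
    have /hext hi : U [set i | proj1 _ a i = proj1 _ a' i].
      by apply: filterS eqi => i /= aa'; rewrite /proj1 aa'.
    apply: filterS3 eqi (filterI Eab Eab') hi => i /= aa' [-> ->] hi.
    by rewrite /tw hi aa'.
  have eq1 : U [set i | proj1 _ a i = proj1 _ a' i].
    apply: filterS3 eqi Eab Eab' => i /= bb' ai a'i; move: bb'.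
    by rewrite ai a'i => -[].
  apply: filterS3 (filterI eqi eq1) (filterI Eab Eab') (hext _ _ eq1) => i /=.
  move=> [bb' a1] [ai a'i] hi; move: bb'; rewrite ai a'i /tw hi.
  move=> [_ /addIr a2].
  by rewrite [a i]surjective_pairing [a' i]surjective_pairing a2; congr pair.
- case=> /= a b Eab.
  + apply: filterS h0 => i; rewrite /mkset => h0i.
    have -> : tw (fun=> 1%g) i = ((1%g : G).1, (1%g : G).2 - h 0 i).
      congr (_, _ - h _ _); apply/funext => j; rewrite /proj1 N2_oneE //.
    by rewrite h0i !N2_oneE subr0.
  + by apply: filterS2 (Eab ord0) (twV (a ord0)) => i /= ->.
  + apply: filterS3 (Eab ord0) (Eab ord_max) (twM (a ord0) (a ord_max)) => i.
    by rewrite /mkset => -> ->.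
- by case.
Qed.

(** * Open formulas and elementary equivalence *)

Section Closure.
Variable L : language.

Lemma family_bound k (P : 'I_k -> nat -> Prop) :
  (forall i, exists m, forall x, P i x -> (x < m)%N) ->
  exists m, forall x, (exists i, P i x) -> (x < m)%N.
Proof.
move=> /choice[m mP]; exists (\max_i m i)%N => x [i Pix].
exact: leq_trans (mP i x Pix) (leq_bigmax i).
Qed.

Lemma or_bound (P Q : nat -> Prop) :
  (exists m, forall x, P x -> (x < m)%N) ->
  (exists m, forall x, Q x -> (x < m)%N) ->
  exists m, forall x, P x \/ Q x -> (x < m)%N.
Proof.
move=> [m Pm] [k Qk]; exists (maxn m k) => x.
by rewrite leq_max => -[/Pm->|/Qk->]; rewrite ?orbT.
Qed.

Lemma term_free_bound (t : term L) :
  exists m, forall x, term_free x t -> (x < m)%N.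
Proof.
by elim: t => [y|s ts IH]; [exists y.+1 => x /= -> | exact: family_bound].
Qed.

Lemma free_bound (phi : formula L) :
  exists m, forall x, Defs.free x phi -> (x < m)%N.
Proof.
elim: phi => [|t u|r ts|p IHp q IHq|y p [m pm]] /=.
- by exists 0%N.
- by apply: or_bound; exact: term_free_bound.
- by apply: family_bound => i; exact: term_free_bound.
- exact: or_bound.
- by exists m => x [_ /pm].
Qed.

(** Binding the variables below k closes every formula whose free variables
are below k. *)
Definition closure (k : nat) (phi : formula L) : formula L :=
  iteri k (@All L) phi.

Lemma free_closure k x phi :
  Defs.free x (closure k phi) -> (k <= x)%N /\ Defs.free x phi.
Proof.
elim: k => [//|k IH] /= [xk /IH[kx xphi]]; split=> //.
by rewrite ltn_neqAle kx andbT; apply/eqP => kx'; apply: xk.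
Qed.

Lemma models_All (M : structure L) x phi :
  models M (All x phi) <-> models M phi.
Proof.
split=> Mphi v; last by move=> a; exact: Mphi.
have := Mphi v (v x); congr (sat _ phi).
by apply/funext => y; rewrite /update; case: eqP => // ->.
Qed.

Lemma models_closure (M : structure L) k phi :
  models M (closure k phi) <-> models M phi.
Proof. by elim: k => //= k IH; rewrite models_All. Qed.

(** An open formula holds under all valuations exactly when its universal
closure does, so elementarily equivalent structures are models of the same
open formulas. *)
Lemma elem_equiv_models (M N : structure L) phi :
  elem_equiv M N -> models M phi <-> models N phi.
Proof.
move=> MN; have [m phim] := free_bound phi.
rewrite -(models_closure M m) -(models_closure N m); apply: MN => x.
by case/free_closure => mx /phim; rewrite ltnNge mx.
Qed.

End Closure.

(** * Interpretation of the group with zero cocycles in the ring *)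

Section Connectives.
Variables (L : language) (M : structure L).

Definition And (p q : formula L) := Imp (Imp p (Imp q Bot)) Bot.

Lemma sat_And (v : nat -> M) p q : sat v (And p q) <-> sat v p /\ sat v q.
Proof.
split=> [npq|[vp vq] /=]; last by apply.
by split; apply: contrapT => nv; apply: npq => /= vp vq; apply: nv.
Qed.

Definition bigAnd (s : seq (formula L)) := foldr And (Imp Bot Bot) s.

Lemma sat_bigAnd (T : eqType) (v : nat -> M) (F : T -> formula L) s :
  sat v (bigAnd (map F s)) <-> forall c, c \in s -> sat v (F c).
Proof.
elim: s => [|c s IH]; first by split=> [_ c //|_ []].
rewrite [bigAnd _]/(And _ _) sat_And IH; split=> [[vc vs] d|vs].
  by rewrite inE => /predU1P[->|/vs].
by split=> [|d ds]; apply: vs; rewrite inE ?eqxx ?ds ?orbT.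
Qed.

Definition bigAll (s : seq nat) (p : formula L) := foldr (@All L) p s.

Lemma sat_bigAll (v : nat -> M) s p :
  sat v (bigAll s p) <->
  forall w : nat -> M, (forall y, y \notin s -> w y = v y) -> sat w p.
Proof.
elim: s v => [|x s IH] v /=.
  split=> [vp w wv|]; last exact.
  by have -> : w = v by apply/funext => y; exact: wv.
split=> [vp w wv|vp a].
  apply: ((IH (update v x (w x))).1 (vp (w x))) => y ys.
  rewrite /update; case: eqP => [->//|/eqP yx].
  by apply: wv; rewrite inE negb_or yx.
apply/IH => w wv; apply: vp => y; rewrite inE negb_or => /andP[yx ys].
by rewrite wv // /update (negPf yx).
Qed.

End Connectives.

Section Interpretation.
Variable n : nat.

Local Notation coord := ('I_n + ltpair n)%type.
Local Notation ring_term := (term ring_language).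

(** Each group variable x is represented by one ring variable for every entry
c. *)
Definition code (x : nat) (c : coord) : nat := pickle (x, c).

Lemma code_inj x y c d : code x c = code y d -> x = y /\ c = d.
Proof. by move=> /(pcan_inj pickleK) [-> ->]. Qed.

Definition tzero : ring_term := @App ring_language RZero (fun _ => Var 0).
Definition topp (t : ring_term) : ring_term :=
  @App ring_language ROpp (fun _ => t).
Definition tadd (t u : ring_term) : ring_term :=
  @App ring_language RAdd (fun i => if i == ord0 then t else u).
Definition tmul (t u : ring_term) : ring_term :=
  @App ring_language RMul (fun i => if i == ord0 then t else u).

Definition interp_inv (t : coord -> ring_term) (c : coord) : ring_term :=
  match c with
  | inl i => topp (t (inl i))
  | inr p => tadd (topp (t (inr p)))
                  (tmul (t (inl (val p).1)) (t (inl (val p).2)))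
  end.

Definition interp_mul (t u : coord -> ring_term) (c : coord) : ring_term :=
  match c with
  | inl i => tadd (t (inl i)) (u (inl i))
  | inr p => tadd (tadd (t (inr p)) (u (inr p)))
                  (tmul (t (inl (val p).1)) (u (inl (val p).2)))
  end.

Fixpoint interp_term (t : term group_language) : coord -> ring_term :=
  match t with
  | Var x => fun c => Var (code x c)
  | App s ts =>
    match s return ('I_(@fun_arity group_language s) -> coord -> ring_term) ->
                   coord -> ring_term with
    | GOne => fun _ _ => tzero
    | GInv => fun us => interp_inv (us ord0)
    | GMul => fun us => interp_mul (us ord0) (us ord_max)
    end (fun i => interp_term (ts i))
  end.

Fixpoint interp (phi : formula group_language) : formula ring_language :=
  match phi with
  | Bot => Bot
  | Eq t u =>
    bigAnd [seq Eq (interp_term t c) (interp_term u c) | c <- enum {: coord}]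
  | Rel r _ => match r with end
  | Imp p q => Imp (interp p) (interp q)
  | All x p => bigAll [seq code x c | c <- enum {: coord}] (interp p)
  end.

Variable R : pzRingType.
Local Notation H := (N2_untwisted n R).
Local Notation MR := (ring_structure R).
Local Notation MH := (group_structure H).

Definition entry (a : H) (c : coord) : R :=
  match c with inl i => a.1 i | inr p => a.2 p end.

Definition of_entries (e : coord -> R) : H :=
  ([ffun i => e (inl i)], [ffun p => e (inr p)]).

Lemma entryK a : of_entries (entry a) = a.
Proof.
by case: a => a b; congr pair; apply/ffunP => i; rewrite ffunE.
Qed.

Lemma of_entriesK e c : entry (of_entries e) c = e c.
Proof. by case: c => i /=; rewrite ffunE. Qed.

Definition decode (v : nat -> MR) (x : nat) : MH :=
  of_entries (fun c => v (code x c)).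

Lemma decode_surj (w : nat -> MH) : exists v, decode v = w.
Proof.
exists (fun m => if unpickle m is Some (x, c) then entry (w x) c else 0).
apply/funext => x; rewrite -[RHS]entryK; congr of_entries; apply/funext => c.
by rewrite /code pickleK.
Qed.

Lemma eval_interp_term v t c :
  eval v (interp_term t c) = entry (eval (decode v) t) c.
Proof.
elim: t c => [x|s ts IH] c /=; first by rewrite of_entriesK.
case: s ts IH => ts IH.
- by case: c => i /=; rewrite ffunE.
- by case: c => i /=; rewrite !IH /= !ffunE //= big1 ?subr0.
- by case: c => i /=; rewrite !IH /= !ffunE //= big1 ?addr0.
Qed.

(** Quantifying over an element of the group is quantifying over its entries,
since every tuple of entries occurs. *)
Lemma sat_interp v phi : sat v (interp phi) <-> sat (decode v) phi.
Proof.
elim: phi v => [|t u|[]|p IHp q IHq|x p IHp] v //=.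
- rewrite sat_bigAnd; split=> [tu|tu c _ /=]; last first.
    by rewrite !eval_interp_term tu.
  rewrite -[LHS]entryK -[RHS]entryK; congr of_entries; apply/funext => c.
  by rewrite -!eval_interp_term; apply: (tu c); rewrite mem_enum.
- by rewrite IHp IHq.
rewrite sat_bigAll; split=> vp.
  move=> a; pose w m := if pickle_inv m is Some (y, c)
    then if y == x then entry a c else v m else v m.
  have <- : decode w = update (decode v) x a.
    apply/funext => y; rewrite /decode /update; case: eqP => [->|/eqP yx].
      rewrite -[RHS]entryK; congr of_entries; apply/funext => c.
      by rewrite /w pickleK_inv eqxx.
    by congr of_entries; apply/funext => c; rewrite /w pickleK_inv (negPf yx).
  apply/IHp; apply: vp => m ms; rewrite /w.
  have /= := @pickle_invK (nat * coord)%type m.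
  case: pickle_inv => [[y c]|//] /= mE.
  case: eqP => // yx; case/mapP: ms; exists c; first by rewrite mem_enum.
  by rewrite -mE yx.
move=> w wv; apply/IHp.
have -> : decode w = update (decode v) x (decode w x).
  apply/funext => y; rewrite /update; case: eqP => [->//|yx].
  congr of_entries; apply/funext => c; apply: wv.
  by apply/mapP => -[d _ /code_inj[]].
exact: vp.
Qed.

Lemma models_interp phi : models MR (interp phi) <-> models MH phi.
Proof.
split=> mod v; last by apply/sat_interp; exact: mod.
by have [w <-] := decode_surj v; apply/sat_interp; exact: mod.
Qed.

End Interpretation.

Theorem untwisted_elem_equiv n (R S : pzRingType) :
  elem_equiv (ring_structure R) (ring_structure S) ->
  elem_equiv (group_structure (N2_untwisted n R))
             (group_structure (N2_untwisted n S)).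
Proof.
by move=> RS phi _; rewrite -!models_interp; exact: elem_equiv_models.
Qed.

(** * Elementary equivalence of the twisted groups *)

Theorem corollary7p5 (n : nat) (R S : idomainType)
    (hn : (2 <= n)%N)
    (charR : [pchar R]%R =i pred0)
    (charS : [pchar S]%R =i pred0)
    (RS : elem_equiv (ring_structure R) (ring_structure S))
    (f : 'I_n -> sym_cocycle2 R (pairsum n R))
    (g : 'I_n -> sym_cocycle2 S (pairsum n S)) :
  elem_equiv (group_structure (N2 f)) (group_structure (N2 g)).
Proof.
move=> phi closed.
have ef := N2_elem_equiv_untwisted f charR closed.
have eg := N2_elem_equiv_untwisted g charS closed.
have e := untwisted_elem_equiv n RS closed.
by split=> [/ef.1/e.1/eg.2|/eg.1/e.2/ef.2].
Qed.
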